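(* Let $\mathcal{SF}$ be the set of all space-filling curves $I\to\mathbb{R}^2$, regarded as a subset of the commutative real algebra $C(I,\mathbb{R}^2)$ with coordinatewise multiplication. Then $\mathcal{SF}$ is strongly algebrable.
   Context: $I=[0,1]$. $C(I,\mathbb{R}^2)$ is the real vector space of continuous functions $I\to\mathbb{R}^2$, which is an algebra under coordinatewise multiplication: $(f_1,f_2)(g_1,g_2)=(f_1g_1,f_2g_2)$. A space-filling curve is a continuous function $\varphi:I\to\mathbb{R}^2$ such that $\varphi(I)$ is Jordan measurable and has positive Jordan content. (A bounded set $S\subset\mathbb{R}^2$ is Jordan measurable if its characteristic function is Riemann integrable, equivalently if its boundary $\partial S$ has Lebesgue measure $0$; its Jordan content is then the Riemann integral of its characteristic function.) A subset $A$ of an algebra is algebrable if there is a subalgebra $M$ (not necessarily with unit) such that $M\setminus\{0\}\subset A$ and $M$ is infinitely generated, that is, every system of generators of $M$ is infinite; $A$ is strongly algebrable if, in addition, $M$ can be taken to be a free algebra. For a commutative algebra, strong algebrability of $A$ means: there is an infinite set $B$ such that for every $N\in\mathbb{N}$, every nonzero polynomial $P$ in $N$ variables (with real coefficients) without constant term, and all distinct $f_1,\dots,f_N\in B$, one has $P(f_1,\dots,f_N)\neq 0$ and $P(f_1,\dots,f_N)\in A$. *)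

(* Defs.v *)
From HB Require Import structures.
From mathcomp Require Import all_boot all_order all_algebra.
From mathcomp Require Import all_classical all_reals all_analysis.
From mathcomp Require Import (canonicals,coercions) mpoly.

Set Implicit Arguments.
Unset Strict Implicit.
Unset Printing Implicit Defensive.

Import Order.TTheory GRing.Theory Num.Theory.
Import numFieldNormedType.Exports.

Local Open Scope classical_set_scope.
Local Open Scope ring_scope.

(* Only the canonical structures and coercions of [mpoly] are imported, because
   its notations clash with those of mathcomp-analysis: [mpoly.mpoly N K] is the
   ring of polynomials in N variables, [mpoly.mcoeff (@mpoly.mnm0 N) P] the
   constant term of P, and [mpoly.mmap (GRing.in_alg A) f P] the value
   P(f_1, ..., f_N) in A. *)
Definition strongly_algebrable (K : fieldType) (A : comAlgType K)
    (E : set A) : Prop :=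
  exists2 B : set A, infinite_set B &
    forall (N : nat) (P : mpoly.mpoly N K) (f : 'I_N -> A),
      P != 0 -> mpoly.mcoeff (@mpoly.mnm0 N) P = 0 ->
      injective f -> (forall i, B (f i)) ->
      mpoly.mmap (GRing.in_alg A) f P != 0
      /\ E (mpoly.mmap (GRing.in_alg A) f P).

Section PlaneContinuity.
Context {R : realType} {X : topologicalType}.
Implicit Types f g : X -> R * R.

Lemma plane_continuousN f : continuous f -> continuous (fun t => - f t).
Proof. by move=> cf t; apply: cvgN; exact: cf. Qed.

Lemma plane_continuousD f g :
  continuous f -> continuous g -> continuous (fun t => f t + g t).
Proof. by move=> cf cg t; apply: cvgD; [exact: cf|exact: cg]. Qed.

Lemma plane_continuousZ (a : R) f :
  continuous f -> continuous (fun t => a *: f t).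
Proof. by move=> cf t; apply: cvgZl_tmp; exact: cf. Qed.

Lemma plane_continuousM f g :
  continuous f -> continuous g -> continuous (fun t => f t * g t).
Proof.
move=> cf cg t.
apply: (@cvg_pair _ _ _ _ (nbhs ((f t).1 * (g t).1)) (nbhs ((f t).2 * (g t).2)));
  apply: cvgM.
- by apply: (cvg_comp _ _ (cf t)); exact: cvg_fst.
- by apply: (cvg_comp _ _ (cg t)); exact: cvg_fst.
- by apply: (cvg_comp _ _ (cf t)); exact: cvg_snd.
- by apply: (cvg_comp _ _ (cg t)); exact: cvg_snd.
Qed.

End PlaneContinuity.

Section PlaneCurves.
Variable R : realType.

Definition unit_itv : topologicalType := set_type [set` `[0 : R, 1]].

Definition plane_curve : Type := continuousType unit_itv (R * R)%type.
HB.instance Definition _ := Choice.on plane_curve.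

Implicit Types f g h : plane_curve.

Lemma plane_curveP f g : (forall t, f t = g t) -> f = g.
Proof. by move=> fg; apply/continuousEP. Qed.

Definition mk_curve (u : unit_itv -> R * R) (cu : continuous u) : plane_curve :=
  (mkcts cu : continuousType unit_itv (R * R)%type).

Definition curve_zero : plane_curve :=
  mk_curve (u := cst 0) (@cst_continuous unit_itv (R * R)%type 0).
Definition curve_one : plane_curve :=
  mk_curve (u := cst 1) (@cst_continuous unit_itv (R * R)%type 1).
Definition curve_opp f : plane_curve :=
  mk_curve (plane_continuousN (@cts_fun _ _ f)).
Definition curve_add f g : plane_curve :=
  mk_curve (plane_continuousD (@cts_fun _ _ f) (@cts_fun _ _ g)).
Definition curve_mul f g : plane_curve :=
  mk_curve (plane_continuousM (@cts_fun _ _ f) (@cts_fun _ _ g)).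
Definition curve_scale (a : R) f : plane_curve :=
  mk_curve (plane_continuousZ (a := a) (@cts_fun _ _ f)).

Fact curve_addA : associative curve_add.
Proof. by move=> f g h; apply: plane_curveP => t; exact: addrA. Qed.
Fact curve_addC : commutative curve_add.
Proof. by move=> f g; apply: plane_curveP => t; exact: addrC. Qed.
Fact curve_add0 : left_id curve_zero curve_add.
Proof. by move=> f; apply: plane_curveP => t; exact: add0r. Qed.
Fact curve_addN : left_inverse curve_zero curve_opp curve_add.
Proof. by move=> f; apply: plane_curveP => t; exact: addNr. Qed.

HB.instance Definition _ := GRing.isZmodule.Build plane_curve
  curve_addA curve_addC curve_add0 curve_addN.

Fact curve_mulA : associative curve_mul.
Proof. by move=> f g h; apply: plane_curveP => t; exact: mulrA. Qed.
Fact curve_mulC : commutative curve_mul.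
Proof. by move=> f g; apply: plane_curveP => t; exact: mulrC. Qed.
Fact curve_mul1 : left_id curve_one curve_mul.
Proof. by move=> f; apply: plane_curveP => t; exact: mul1r. Qed.
Fact curve_mulDl : left_distributive curve_mul curve_add.
Proof. by move=> f g h; apply: plane_curveP => t; exact: mulrDl. Qed.
Fact curve_one_neq0 : curve_one != 0 :> plane_curve.
Proof.
have I0 : (0 : R) \in [set` `[0 : R, 1]] by rewrite inE /= in_itv /= lexx ler01.
apply/eqP => /continuousEP /(_ (exist _ 0 I0)) [/eqP].
by rewrite oner_eq0.
Qed.

HB.instance Definition _ := GRing.Zmodule_isComNzRing.Build plane_curve
  curve_mulA curve_mulC curve_mul1 curve_mulDl curve_one_neq0.

Fact curve_scaleA a b f : curve_scale a (curve_scale b f) = curve_scale (a * b) f.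
Proof. by apply: plane_curveP => t; exact: scalerA. Qed.
Fact curve_scale1 : left_id 1 curve_scale.
Proof. by move=> f; apply: plane_curveP => t; exact: scale1r. Qed.
Fact curve_scaleDr : right_distributive curve_scale +%R.
Proof. by move=> a f g; apply: plane_curveP => t; exact: scalerDr. Qed.
Fact curve_scaleDl f : {morph curve_scale^~ f : a b / a + b}.
Proof. by move=> a b; apply: plane_curveP => t; exact: scalerDl. Qed.

HB.instance Definition _ := GRing.Zmodule_isLmodule.Build R plane_curve
  curve_scaleA curve_scale1 curve_scaleDr curve_scaleDl.

Fact curve_scaleAl (a : R) f g : a *: (f * g) = (a *: f) * g.
Proof. by apply: plane_curveP => t; exact: scalerAl. Qed.

HB.instance Definition _ := GRing.Lmodule_isLalgebra.Build R plane_curve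
  curve_scaleAl.
HB.instance Definition _ := GRing.Lalgebra_isComAlgebra.Build R plane_curve.

End PlaneCurves.

Section JordanContent.
Variable R : realType.
Implicit Types (a b c d v : R) (F : R * R -> R) (S : set (R * R)).

Definition rectangle a b c d : set (R * R) := `[a, b] `*` `[c, d].

Section DarbouxSums.
Variables (a c : R) (s t : seq R) (F : R * R -> R).

(* As for [itv_partition], the subdivision points of [a, b] are those of the
   list a :: s, with b the last one (same for [c, d] and c :: t). *)
Let x (i : nat) : R := nth 0 (a :: s) i.
Let y (j : nat) : R := nth 0 (c :: t) j.
Let cell (i j : nat) := rectangle (x i) (x i.+1) (y j) (y j.+1).
Let area (i j : nat) : R := (x i.+1 - x i) * (y j.+1 - y j).

Definition lower_darboux_sum : R :=
  \sum_(i < size s) \sum_(j < size t) inf (F @` cell i j) * area i j.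
Definition upper_darboux_sum : R :=
  \sum_(i < size s) \sum_(j < size t) sup (F @` cell i j) * area i j.

End DarbouxSums.

Definition lower_integral a b c d F : R :=
  sup [set v | exists s t, [/\ itv_partition a b s, itv_partition c d t &
    v = lower_darboux_sum a c s t F]].
Definition upper_integral a b c d F : R :=
  inf [set v | exists s t, [/\ itv_partition a b s, itv_partition c d t &
    v = upper_darboux_sum a c s t F]].

Definition is_riemann_integral a b c d F v : Prop :=
  [/\ exists M, forall p, rectangle a b c d p -> `|F p| <= M,
      lower_integral a b c d F = v & upper_integral a b c d F = v].

(* [is_jordan_content S v]: S is a (necessarily bounded) Jordan measurable set
   and v is its Jordan content. Neither the integrability of the characteristic
   function of S nor the value of its integral depends on the choice of the
   closed rectangle containing S. *)
Definition is_jordan_content S v : Prop :=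
  exists a b c d, [/\ a < b, c < d, S `<=` rectangle a b c d &
    is_riemann_integral a b c d \1_S v].

Definition jordan_measurable S : Prop := exists v, is_jordan_content S v.

Definition space_filling : set (plane_curve R) :=
  [set phi | jordan_measurable (range phi) /\
             exists2 v, is_jordan_content (range phi) v & 0 < v].

End JordanContent.

(* Main.v *)
Require Import Defs.
From HB Require Import structures.
From mathcomp Require Import all_boot all_order all_algebra.
From mathcomp Require Import all_classical all_reals all_analysis.
From mathcomp Require Import ring lra.
From mathcomp Require Import (canonicals,coercions) mpoly.

Set Implicit Arguments.
Unset Strict Implicit.
Unset Printing Implicit Defensive.

Import Order.TTheory GRing.Theory Num.Theory.
Import numFieldNormedType.Exports.

Local Open Scope classical_set_scope.
Local Open Scope ring_scope.

(** Let [(x, y)] map [0,1] onto the unit square. If [g_n = x \o y^n], where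
    [y^n] is the n-th iterate of [y], then any finitely many of the [g_n] map
    [0,1] onto a cube: unfold the preimages of [(a_0, t_1)], [(a_1, t_2)], ...
    one after the other. Hence, for a nonzero polynomial P without constant
    term, [h = P(g_n1, ..., g_nN)] is not constant on [0,1] and
    [h([0,1]) = [a, b]] with [a < b]. The curves [F_n = (g_n \o x, g_n \o y)]
    are then free generators: [P(F_n1, ..., F_nN) = (h \o x, h \o y)] has image
    [[a, b] x [a, b]], because [(x, y)] is onto the square.

    The curve [(x, y)] is a variant of Schoenberg's: [T] folds each of [0,1/3]
    and [2/3,1] onto [0,1], [u] is 0 on the former and 1 on the latter, [x]
    solves [x = (u + x \o T \o T) / 2], and [y = x \o T], so that [x t] and
    [y t] read off alternate binary digits of the itinerary of [t]. *)

(** * Nonzero polynomials on the unit cube *)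

Lemma mmap_rmorph (N : nat) (K : nzRingType) (A B : nzRingType)
    (e : {rmorphism A -> B}) (h : K -> A) (f : 'I_N -> A)
    (P : mpoly.mpoly N K) :
  e (mpoly.mmap h f P) = mpoly.mmap (e \o h) (e \o f) P.
Proof.
rewrite /mpoly.mmap rmorph_sum; apply: eq_bigr => m _ /=.
rewrite rmorphM rmorph_prod; congr (_ * _).
by apply: eq_bigr => i _; rewrite rmorphXn.
Qed.

(** The points [1/(i+1)] with [i < size q] lie in the interval and are more numerous than the roots
    of [q] can be. *)
Lemma poly_nonroot_unit_itv (R : realFieldType) (q : {poly R}) :
  q != 0 -> exists2 s, 0 <= s <= 1 & q.[s] != 0.
Proof.
move=> q0; pose r := [seq i.+1%:R^-1 : R | i <- iota 0 (size q)].
have ur : uniq r.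
  rewrite map_inj_uniq ?iota_uniq// => i j /invr_inj /eqP.
  by rewrite eqr_nat eqSS => /eqP.
have : ~~ all (root q) r.
  apply/negP => /(max_poly_roots q0)/(_ ur).
  by rewrite size_map size_iota ltnn.
move=> /allPn[_ /mapP[i _ ->] nr]; exists i.+1%:R^-1 => //.
by rewrite invr_ge0 ler0n/= invf_le1 ?ltr0n// ler1n.
Qed.

(* Induction on N, with P seen as a polynomial in its last variable. *)
Lemma mpoly_nonroot_cube (R : realFieldType) (N : nat) (P : mpoly.mpoly N R) :
  P != 0 -> exists2 v, (forall i, 0 <= v i <= 1) & mpoly.meval v P != 0.
Proof.
elim: N => [|N IH] in P *; move=> P0.
all: have mP := mpoly.mlead_supp P0; set m0 := mpoly.mlead P in mP.
all: have Pm0 : mpoly.mcoeff m0 P != 0 by rewrite -mpoly.mcoeff_msupp.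
  exists (fun=> 0); first by case.
  rewrite (_ : P = mpoly.mpolyC 0 (mpoly.mcoeff m0 P)) ?mpoly.mevalC//.
  apply/mpoly.mpolyP => m; rewrite mpoly.mcoeffC.
  have m_unique (m1 m2 : mpoly.multinom 0) : m1 = m2 by apply/mpoly.mnmP => -[].
  by rewrite (m_unique m m0) (m_unique m0 (mpoly.mnm0 (n:=0))) eqxx mulr1.
pose wid := widen_ord (leqnSn N).
have widE i : wid i = lift ord_max i.
  by apply/val_inj; rewrite /= /bump leqNgt ltn_ord.
(* A monomial [m] is determined by [rest m] and its last exponent. Hence the coefficient of [Q]
   below at [rest m0] is that of [P] at [m0], which is nonzero. *)
pose rest (m : mpoly.multinom N.+1) : mpoly.multinom N :=
  mpoly.Multinom [tuple m (wid i) | i < N].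
have restE m i : rest m i = m (wid i) by rewrite mpoly.mnmE.
pose Q := (mpoly.muni P)`_(m0 ord_max).
have Q0 : Q != 0.
  apply: contraNneq Pm0 => /(congr1 (mpoly.mcoeff (rest m0))).
  rewrite mpoly.mcoeff0 /Q mpoly.muniE coef_sum raddf_sum/=.
  rewrite (bigD1_seq m0) ?mpoly.msupp_uniq//= big1 ?addr0 => [<-|m mm0].
    rewrite coefZ coefXn eqxx mulr1.
    by rewrite mpoly.mcoeffZ mpoly.mcoeffX eqxx mulr1.
  rewrite coefZ coefXn; have [mx|] := eqVneq.
    2: by rewrite mulr0 mpoly.mcoeff0.
  rewrite mulr1 mpoly.mcoeffZ mpoly.mcoeffX; have [mr|] := eqVneq.
    2: by rewrite mulr0.
  case/eqP: mm0; apply/mpoly.mnmP => i.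
  have [j ->|->//] := unliftP ord_max i.
  by rewrite -widE -!restE -mr.
have [v v01 Qv] := IH Q Q0.
(* Fixing the first N variables at [v] leaves a univariate polynomial; it is nonzero because its
   coefficient of degree [m0 ord_max] is [Q] evaluated at [v]. *)
pose q := map_poly (mpoly.meval v) (mpoly.muni P).
have q0 : q != 0.
  apply: contraNneq Qv => /(congr1 (fun p : {poly R} => p`_(m0 ord_max))).
  by rewrite coef_map coef0 /Q => ->.
have [s s01 qs] := poly_nonroot_unit_itv q0.
pose u (i : 'I_N.+1) := if unlift ord_max i is Some j then v j else s.
exists u => [i|]; first by rewrite /u; case: unlift.
suff -> : mpoly.meval u P = q.[s] by [].
rewrite /q mpoly.muniE rmorph_sum horner_sum mpoly.mevalE.
apply: eq_bigr => m _ /=.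
rewrite map_polyZ/= map_polyXn hornerZ hornerXn.
rewrite mpoly.mevalZ mpoly.mevalX -mulrA.
rewrite big_ord_recr/= /u unlift_none; congr (_ * (_ * _)).
apply: eq_bigr => i _; rewrite -/wid -restE.
by rewrite widE liftK.
Qed.

(** * Jordan content of a rectangle *)

Lemma itv_partition_sum (R : realType) (a b : R) (s : seq R) :
  itv_partition a b s ->
  \sum_(i < size s) (nth 0 (a :: s) i.+1 - nth 0 (a :: s) i) = b - a.
Proof.
move=> [_ /eqP <-].
rewrite -(big_mkord xpredT (fun i => nth 0 (a :: s) i.+1 - nth 0 (a :: s) i)).
by rewrite telescope_sumr// -last_nth nth0.
Qed.

Lemma itv_partition_cell (R : realType) (a b : R) (s : seq R)
    (i : 'I_(size s)) :
  itv_partition a b s ->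
  [/\ a <= nth 0 (a :: s) i, nth 0 (a :: s) i <= nth 0 (a :: s) i.+1
    & nth 0 (a :: s) i.+1 <= b].
Proof.
move=> [as_ /eqP sb].
have le_nth (k l : nat) : (k <= l <= size s)%N ->
    nth 0 (a :: s) k <= nth 0 (a :: s) l.
  move=> /andP[kl ls]; have ss : sorted <=%O (a :: s).
    by rewrite /=; apply: sub_path as_ => u w; exact: ltW.
  apply: (sorted_leq_nth le_trans lexx 0 ss) => //; rewrite inE /= ltnS//.
  exact: leq_trans ls.
split; first by apply: (le_nth 0%N i); rewrite /= ltnW.
- by apply: le_nth; rewrite leqnSn/=.
- by rewrite -sb (last_nth 0); apply: le_nth; rewrite leqnn andbT.
Qed.

Lemma indic_rectangle_cell (R : realType) (a b c d x x' y y' : R) :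
  a <= x <= x' -> x' <= b -> c <= y <= y' -> y' <= d ->
  (\1_(rectangle a b c d) : R * R -> R) @` rectangle x x' y y' = [set 1].
Proof.
move=> /andP[ax xx'] x'b /andP[cy yy'] y'd; apply/seteqP; split.
  move=> _ [[p q] [+ +] <-].
  rewrite /= !in_itv/= => /andP[xp px'] /andP[yq qy'].
  rewrite indicE mem_set//; split; rewrite /= in_itv/=.
    by rewrite (le_trans ax xp) (le_trans px' x'b).
  by rewrite (le_trans cy yq) (le_trans qy' y'd).
move=> _ ->; exists (x, y); first by split; rewrite /= in_itv/= lexx.
rewrite indicE mem_set//; split; rewrite /= in_itv/=.
  by rewrite ax (le_trans xx').
by rewrite cy (le_trans yy').
Qed.

(** With the rectangle itself as the enclosing one, the indicator is 1 on every cell, so all lower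
    and upper Darboux sums equal the area. *)
Lemma rectangle_jordan_content (R : realType) (a b c d : R) :
  a < b -> c < d -> is_jordan_content (rectangle a b c d) ((b - a) * (d - c)).
Proof.
move=> ab cd; pose S := rectangle a b c d.
(* [I] stands for [inf] or [sup], so that both kinds of sums are treated at once. *)
have area s t : itv_partition a b s -> itv_partition c d t ->
    forall I : set R -> R, I [set 1] = 1 ->
    \sum_(i < size s) \sum_(j < size t)
      I ((\1_S : R * R -> R) @`
           rectangle (nth 0 (a :: s) i) (nth 0 (a :: s) i.+1)
                     (nth 0 (c :: t) j) (nth 0 (c :: t) j.+1))
      * ((nth 0 (a :: s) i.+1 - nth 0 (a :: s) i)
         * (nth 0 (c :: t) j.+1 - nth 0 (c :: t) j)) = (b - a) * (d - c).
  move=> abs cdt I I1.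
  rewrite -(itv_partition_sum abs) -(itv_partition_sum cdt) mulr_suml.
  apply: eq_bigr => i _; rewrite mulr_sumr; apply: eq_bigr => j _.
  have [ax xx' x'b] := itv_partition_cell i abs.
  have [cy yy' y'd] := itv_partition_cell j cdt.
  by rewrite indic_rectangle_cell ?ax ?cy// I1 mul1r.
have values (D : seq R -> seq R -> R) :
    (forall s t, itv_partition a b s -> itv_partition c d t ->
      D s t = (b - a) * (d - c)) ->
    [set v | exists s t, [/\ itv_partition a b s, itv_partition c d t &
      v = D s t]] = [set (b - a) * (d - c)].
  move=> DE; apply/seteqP; split => [v [s [t [abs cdt ->]]]|_ ->/=].
    exact: DE.
  have [abb cdd] := (itv_partition1 ab, itv_partition1 cd).
  (* The trivial subdivisions show that the set of sums is not empty. *)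
  by exists [:: b], [:: d]; rewrite DE.
exists a, b, c, d; split => //; split.
- exists 1 => p _; rewrite indicE; case: (_ \in _); rewrite ?normr1 ?normr0//.
- rewrite /lower_integral values ?sup1// => s t abs cdt.
  by apply: (area s t abs cdt inf); rewrite inf1.
- rewrite /upper_integral values ?inf1// => s t abs cdt.
  by apply: (area s t abs cdt sup); rewrite sup1.
Qed.

(** * A continuous curve onto the unit square *)

Lemma exists_half_pow_lt (R : archiRealFieldType) (e : R) :
  0 < e -> exists n, (2 ^+ n)^-1 < e.
Proof.
move=> e0; have half : `|2^-1 : R| < 1 by rewrite ger0_norm; lra.
have /cvgrPdist_lt/(_ e e0)[n _ /(_ n (leqnn n))] := cvg_geometric 1 half.
rewrite /= sub0r normrN mul1r exprVn ger0_norm ?invr_ge0 ?exprn_ge0// => ?.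
by exists n.
Qed.

(** The solution is the series of [u (iter k T t) / 2 ^+ k.+1]; its tails are uniformly small,
    whence continuity. *)
Lemma halving_equation_solution (R : realType) (X : topologicalType)
    (u : X -> R) (T : X -> X) :
  continuous u -> (forall t, 0 <= u t <= 1) -> continuous T ->
  exists x : X -> R, [/\ continuous x, forall t, 0 <= x t <= 1 &
    forall t, x t = (u t + x (T t)) / 2].
Proof.
move=> cu u01 cT.
pose S n t := \sum_(k < n) u (iter k T t) / 2 ^+ k.+1.
have S_rec n t : S n.+1 t = (u t + S n (T t)) / 2.
  rewrite /S big_ord_recl expr1 mulrDl; congr (_ + _).
  rewrite mulr_suml; apply: eq_bigr => i _.
  by rewrite !lift0 iterSr -mulrA -invfM -exprSr.
have S01 n t : 0 <= S n t <= 1.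
  elim: n => [|n IH] in t *; first by rewrite /S big_ord0 lexx ler01.
  rewrite S_rec; have /andP[? ?] := IH (T t); have /andP[? ?] := u01 t.
  by apply/andP; split; lra.
have S_cvg t : cvgn (S ^~ t).
  apply: nondecreasing_is_cvgn.
    apply/nondecreasing_seqP => n; rewrite /S big_ord_recr/= lerDl.
    by rewrite divr_ge0 ?exprn_ge0//; have /andP[] := u01 (iter n T t).
  by exists 1 => _ [n _ <-]; have /andP[] := S01 n t.
pose x t := limn (S ^~ t).
have x01 t : 0 <= x t <= 1.
  apply/andP; split.
    by apply: limr_ge => //; apply: nearW => n; have /andP[] := S01 n t.
  by apply: limr_le => //; apply: nearW => n; have /andP[] := S01 n t.
(* Both sides are limits of [S n.+1 t]. *)
have x_rec t : x t = (u t + x (T t)) / 2.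
  apply: (@cvg_unique _ (@norm_hausdorff _ R) ((fun n => S n.+1 t) @ \oo)).
    by have := S_cvg t; rewrite -cvg_shiftS.
  rewrite (_ : (fun n => S n.+1 t) = (fun n => (u t + S n (T t)) / 2)).
    2: by apply/funext => n; exact: S_rec.
  by apply: cvgMl; apply: cvgD; [exact: cvg_cst|exact: S_cvg].
exists x; split => //.
have x_iter n t : x t = S n t + x (iter n T t) / 2 ^+ n.
  elim: n => [|n IH] in t *; first by rewrite /S big_ord0 expr0 divr1 add0r.
  rewrite x_rec IH S_rec -iterSr exprS invfM; ring.
have cS n : continuous (S n).
  elim: n => [|n IH].
    rewrite (_ : S 0%N = cst 0); first exact: cst_continuous.
    by apply/funext => t; rewrite /S big_ord0.
  rewrite (_ : S n.+1 = fun t => (u t + S n (T t)) / 2).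
    2: by apply/funext => t; exact: S_rec.
  move=> t; apply: cvgMl; apply: cvgD; first exact: cu.
  exact: (continuous_comp (cT t) (IH _)).
move=> t; apply/cvgrPdist_lt => e e0.
(* By [x_iter], [x] and [S n] differ by a remainder in [[0, 2^-n]]. Two remainders thus differ by
   less than [e / 2], and continuity of [S n] provides the other half. *)
have [n ne] : exists n, (2 ^+ n)^-1 < e / 2.
  exact: exists_half_pow_lt (divr_gt0 e0 (ltr0n _ 2)).
have /cvgrPdist_lt/(_ (e / 2)) := cS n t.
move=> /(_ ltac:(lra)); apply: filterS => s.
rewrite (x_iter n t) (x_iter n s).
have q0 : 0 <= (2 ^+ n : R)^-1 by rewrite invr_ge0 exprn_ge0.
have := x01 (iter n T t); have := x01 (iter n T s).
set q := _^-1 in ne q0 *.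
rewrite !ltr_norml => /andP[? ?] /andP[? ?] /andP[? ?]; apply/andP; split; nra.
Qed.

(** Binary digits of [p] and [q] can be prescribed to any depth, so the image is dense in the
    square; compactness of the interval then gives surjectivity. *)
Lemma unit_square_curve (R : realType) : exists x y : R -> R,
  [/\ continuous x, continuous y, forall t, 0 <= x t <= 1,
      forall t, 0 <= y t <= 1 &
      forall p q, 0 <= p <= 1 -> 0 <= q <= 1 ->
        exists t, [/\ 0 <= t <= 1, x t = p & y t = q]].
Proof.
(* On the outer thirds [T t] is [1 - 3 * t] and [3 * t - 2]. It can leave the unit interval on the
   middle third, so [x] and [y] are built on all of [R]. *)
pose T (t : R) : R := `|3 * t - 3 / 2| - 1 / 2.
pose u (t : R) : R := (1 + `|3 * t - 1| - `|3 * t - 2|) / 2.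
have c_aff (a b : R) : continuous (fun t : R => a * t - b).
  move=> t; apply: cvgB; last exact: cvg_cst.
  by apply: cvgM; [exact: cvg_cst|exact: cvg_id].
have cT : continuous T.
  move=> t; apply: cvgB; last exact: cvg_cst.
  by apply: cvg_norm; exact: c_aff.
have cu : continuous u.
  move=> t; apply: cvgM; last exact: cvg_cst.
  apply: cvgB; last by apply: cvg_norm; exact: c_aff.
  by apply: cvgD; [exact: cvg_cst|apply: cvg_norm; exact: c_aff].
have u01 t : 0 <= u t <= 1.
  have : `|(3 * t - 1) - (3 * t - 2)| <= 1 by rewrite ger0_norm; lra.
  move=> /(le_trans (ler_dist_dist _ _)); rewrite ler_norml /u => /andP[? ?].
  by apply/andP; split; lra.
have cTT : continuous (T \o T).
  by move=> t; exact: (continuous_comp (cT t) (cT _)).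
have [x [cx x01 x_rec]] := halving_equation_solution cu u01 cTT.
pose y := x \o T.
have cy : continuous y.
  by move=> t; exact: (continuous_comp (cT t) (cx _)).
have y01 t : 0 <= y t <= 1 by exact: x01.
pose digit (b : bool) : R := b%:R.
have branch (b : bool) (s : R) : 0 <= s <= 1 ->
    exists t, [/\ 0 <= t <= 1, T t = s & u t = digit b].
  (* These are the two inverse branches of [T], with values in the right and left thirds. *)
  move=> /andP[s0 s1]; exists (if b then (2 + s) / 3 else (1 - s) / 3); split.
  - by case: b; apply/andP; split; lra.
  - rewrite /T; case: b.
      by rewrite ger0_norm; lra.
    by rewrite ler0_norm; lra.
  - rewrite /u /digit; case: b => /=.
      by rewrite !ger0_norm; lra.
    by rewrite !ler0_norm; lra.
have self_similar (b c : bool) (t : R) : 0 <= t <= 1 ->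
    exists t', [/\ 0 <= t' <= 1, x t' = (digit b + x t) / 2
      & y t' = (digit c + y t) / 2].
  (* Two steps back from [t]: the orbit [t'], [s], [t] of [T] has digits [b] at [t'] and [c] at [s].
     The former enters [x t'], the latter [y t' = x s]. *)
  move=> t01; have [s [s01 Ts us]] := branch c t t01.
  have [t' [t'01 Tt' ut']] := branch b s s01; exists t'; split => //.
    by rewrite x_rec ut' /= Tt' Ts.
  by rewrite /y /= Tt' x_rec us /= Ts.
have halve (p : R) : 0 <= p <= 1 ->
    exists b p', 0 <= p' <= 1 /\ p = (digit b + p') / 2.
  move=> /andP[p0 p1]; have [ph|ph] := leP p (1 / 2).
    by exists false, (2 * p); split; [apply/andP; split|rewrite /digit/=]; lra.
  exists true, (2 * p - 1).
  by split; [apply/andP; split|rewrite /digit/=]; lra.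
have approx n p q : 0 <= p <= 1 -> 0 <= q <= 1 -> exists t, [/\ 0 <= t <= 1,
    `|p - x t| <= (2 ^+ n)^-1 & `|q - y t| <= (2 ^+ n)^-1].
  elim: n => [|n IH] in p q *; move=> p01 q01.
    exists 0; split; rewrite ?lexx ?ler01// expr0 invr1.
      have := x01 0; move: p01 => /andP[? ?] /andP[? ?].
      by rewrite ler_norml; apply/andP; split; lra.
    have := y01 0; move: q01 => /andP[? ?] /andP[? ?].
    by rewrite ler_norml; apply/andP; split; lra.
  have [b [p' [p'01 ->]]] := halve p p01.
  have [c [q' [q'01 ->]]] := halve q q01.
  have [t [t01 pt qt]] := IH p' q' p'01 q'01.
  have [t' [t'01 xt' yt']] := self_similar b c t t01.
  exists t'; rewrite xt' yt'; split => //.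
    move: pt; rewrite exprS invfM !ler_norml => /andP[? ?].
    by apply/andP; split; lra.
  move: qt; rewrite exprS invfM !ler_norml => /andP[? ?].
  by apply/andP; split; lra.
exists x, y; split => // p q p01 q01.
(* The infimum of f is attained, and it is 0 by approx. *)
pose f t := `|p - x t| + `|q - y t|.
have cf : continuous f.
  move=> t; apply: cvgD; apply: cvg_norm; apply: cvgB; try exact: cvg_cst.
    exact: cx.
  exact: cy.
have [t + tmin] := @EVT_min R f 0 1 ler01 (continuous_subspaceT cf).
rewrite in_itv/= => t01; exists t.
suff ft : f t = 0.
  move/eqP: ft; rewrite paddr_eq0// !normr_eq0 !subr_eq0.
  by move=> /andP[/eqP -> /eqP ->].
apply/eqP; rewrite eq_le addr_ge0// andbT.
apply/ler_addgt0Pr => e e0; rewrite add0r.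
have [n ne] := exists_half_pow_lt (divr_gt0 e0 (ltr0n _ 2)).
have [s [s01 ps qs]] := approx n p q p01 q01.
apply: (le_trans (tmin s _)); first by rewrite in_itv.
rewrite /f; lra.
Qed.

(** * Continuous functions: polynomial expressions, images of segments, iterates *)

Lemma meval_at0 (R : idomainType) (N : nat) (P : mpoly.mpoly N R) :
  mpoly.meval (fun=> 0) P = mpoly.mcoeff (@mpoly.mnm0 N) P.
Proof.
have mon0 m : m != @mpoly.mnm0 N -> \prod_(i < N) (0 : R) ^+ m i = 0.
  move=> m0; have [i mi] : exists i, m i != 0%N.
    apply/existsP; apply: contraNT m0 => /existsPn m0.
    by apply/eqP/mpoly.mnmP => i; rewrite mpoly.mnm0E; apply/eqP/negPn.
  by rewrite (bigD1 i)//= expr0n (negbTE mi) mul0r.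
rewrite mpoly.mevalE; have [P0|P0] := boolP (@mpoly.mnm0 N \in mpoly.msupp P).
  rewrite (bigD1_seq _ P0) ?mpoly.msupp_uniq//= [X in _ * X]big1 => [|i _].
    by rewrite mulr1 big1 ?addr0// => m /mon0 ->; rewrite mulr0.
  by rewrite mpoly.mnm0E expr0.
rewrite (mpoly.memN_msupp_eq0 P0) big1_seq// => m /andP[_ mP].
by rewrite mon0 ?mulr0//; apply: contraNneq P0 => <-.
Qed.

Lemma continuous_meval (R : realType) (X : topologicalType) (N : nat)
    (P : mpoly.mpoly N R) (g : 'I_N -> X -> R) :
  (forall i, continuous (g i)) -> continuous (fun t => mpoly.meval (g ^~ t) P).
Proof.
move=> cg; apply: continuous_big => [|m _]; first exact: add_continuous.
move=> t; apply: cvgM; first exact: cvg_cst.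
move: t; apply: continuous_big => [|i _]; first exact: mul_continuous.
move=> t; exact: (continuous_comp (cg i t) (@exprn_continuous R (m i) _)).
Qed.

(** The endpoints are the extreme values; the intermediate value theorem, in either order of the
    points where they are attained, fills the segment. *)
Lemma continuous_segment_image (R : realType) (h : R -> R) : continuous h ->
  exists a b, h @` `[0, 1] = `[a, b]%classic.
Proof.
move=> ch; have cw A : {within A, continuous h} := continuous_subspaceT ch.
have [s s01 smin] := EVT_min ler01 (cw _).
have [t t01 tmax] := EVT_max ler01 (cw _).
exists (h s), (h t); apply/seteqP; split => [_ [r r01 <-]|v].
  by rewrite /= in_itv/= smin// tmax.
rewrite /= in_itv/= => /andP[sv vt].
have [st|ts] := leP s t.
  have [|r] := @IVT R h s t v st (cw _).
    by rewrite ge_min sv le_max vt orbT.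
  rewrite in_itv/= => /andP[sr rt] <-; exists r => //; rewrite /= in_itv/=.
  move: s01 t01; rewrite !in_itv/= => /andP[s0 _] /andP[_ t1].
  by rewrite (le_trans s0)// (le_trans rt).
have [|r] := @IVT R h t s v (ltW ts) (cw _).
  by rewrite ge_min sv orbT le_max vt.
rewrite in_itv/= => /andP[tr rs] <-; exists r => //; rewrite /= in_itv/=.
move: s01 t01; rewrite !in_itv/= => /andP[_ s1] /andP[t0 _].
by rewrite (le_trans t0)// (le_trans rs).
Qed.

(** Induction on [n]: if [t] realizes the shifted sequence, a point [s] with [x s = a 0] and
    [y s = t] realizes [a]. *)
Lemma iterated_curve_onto_cube (R : realType) (x y : R -> R) :
    (forall p q, 0 <= p <= 1 -> 0 <= q <= 1 ->
      exists t, [/\ 0 <= t <= 1, x t = p & y t = q]) ->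
  forall (a : nat -> R), (forall n, 0 <= a n <= 1) ->
  forall n, exists2 t, 0 <= t <= 1 &
    forall i, (i < n)%N -> x (iter i y t) = a i.
Proof.
move=> xy a a01 n.
elim: n => [|n IH] in a a01 *; first by exists 0; rewrite ?lexx ?ler01.
have [t t01 ta] := IH (a \o succn) (fun i => a01 i.+1).
have [s [s01 xs ys]] := xy (a 0%N) t (a01 0%N) t01.
by exists s => // -[|i] ilt //; rewrite iterSr ys ta.
Qed.

(** * Pointwise evaluation of polynomials in curves *)

Section CurveEval.
Variables (R : realType) (t : unit_itv R).

(** Evaluation at [t] is named so that ring morphism structures can be attached to it. *)
Definition curve_eval (phi : plane_curve R) : R * R := phi t.

Fact curve_eval_is_additive : zmod_morphism curve_eval.
Proof. by []. Qed.
HB.instance Definition _ :=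
  GRing.isZmodMorphism.Build (plane_curve R) (R * R)%type curve_eval
    curve_eval_is_additive.

Fact curve_eval_is_monoid_morphism : monoid_morphism curve_eval.
Proof. by []. Qed.
HB.instance Definition _ :=
  GRing.isMonoidMorphism.Build (plane_curve R) (R * R)%type curve_eval
    curve_eval_is_monoid_morphism.

Lemma curve_eval_mmap (N : nat) (P : mpoly.mpoly N R)
    (f : 'I_N -> plane_curve R) :
  mpoly.mmap (GRing.in_alg (plane_curve R)) f P t =
  (mpoly.meval (fun i => (f i t).1) P, mpoly.meval (fun i => (f i t).2) P).
Proof.
rewrite -/(curve_eval _) [LHS]surjective_pairing.
(* Evaluation followed by a projection is a ring morphism to [R], so [mmap_rmorph] applies to each
   coordinate. *)
rewrite -[(curve_eval _).1]/((fst \o curve_eval) _).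
rewrite -[(curve_eval _).2]/((snd \o curve_eval) _).
rewrite !mmap_rmorph; congr (_, _).
all: by apply: eq_bigr => m _; congr (_ * _); rewrite /=; exact: mulr1.
Qed.

End CurveEval.

(** * Squares as images, and the free generators *)

Lemma space_filling_square (R : realType) (a b : R) (phi : plane_curve R) :
  a < b -> range phi = rectangle a b a b -> space_filling phi.
Proof.
move=> ab phiE; have content := rectangle_jordan_content ab ab.
have phic : is_jordan_content (range phi) ((b - a) * (b - a)) by rewrite phiE.
split; first by exists ((b - a) * (b - a)).
by exists ((b - a) * (b - a)); rewrite // mulr_gt0 ?subr_gt0.
Qed.

Theorem theorem4p7 (R : realType) : strongly_algebrable (@space_filling R).
Proof.
have [x [y [cx cy x01 y01 xy]]] := unit_square_curve R.
pose G n t := x (iter n y t).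
have cG n : continuous (G n).
  elim: n => [|n IH] t; first exact: cx.
  rewrite (_ : G n.+1 = G n \o y); first exact: (continuous_comp (cy t) (IH _)).
  by apply/funext => s; rewrite /G iterSr.
have G_onto := iterated_curve_onto_cube xy.
have cval : continuous (fun t : unit_itv R => set_val t : R).
  exact: initial_continuous.
have cF n : continuous (fun t : unit_itv R =>
    (G n (x (set_val t)), G n (y (set_val t)))).
  move=> t; have cGz (z : R -> R) : continuous z ->
      {for t, continuous (fun s : unit_itv R => G n (z (set_val s)))}.
    move=> cz; have cGnz : {for set_val t, continuous (G n \o z)}.
      exact: (continuous_comp (cz _) (cG n _)).
    exact: (continuous_comp (cval t) cGnz).
  exact: (cvg_pair (cGz x cx) (cGz y cy)).
pose F n : plane_curve R := mk_curve (cF n).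
have unit_itv_onto p q : 0 <= p <= 1 -> 0 <= q <= 1 ->
    exists t : unit_itv R, x (set_val t) = p /\ y (set_val t) = q.
  move=> p01 q01; have [t [t01 xt yt]] := xy p q p01 q01.
  have tI : t \in [set` `[0 : R, 1]] by rewrite inE /= in_itv.
  by exists (exist _ t tI).
have F_inj : injective F.
  move=> i j Fij; apply/eqP/negP => /negP ij.
  (* At this point [G i] is 1 and [G j] is 0; the length [(maxn i j).+1] covers both indices. *)
  have [|s s01 sG] := G_onto (fun k => (k == i)%:R) _ (maxn i j).+1.
    by move=> k; case: eqP; rewrite ?lexx ?ler01.
  have [t [xt _]] := unit_itv_onto s s s01 s01.
  have : (F i t).1 = (F j t).1 by rewrite Fij.
  rewrite /F /= xt [LHS]sG ?ltnS ?leq_maxl// [RHS]sG ?ltnS ?leq_maxr//.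
  by rewrite eqxx eq_sym (negbTE ij) => /eqP; rewrite oner_eq0.
exists (range F).
  move=> /(finite_preimage (f := F)) fin; apply: infinite_nat.
  rewrite (_ : setT = F @^-1` range F).
    2: by apply/seteqP; split => // i _; exists i.
  by apply: fin => i j _ _; exact: F_inj.
move=> N P f P0 Pconst f_inj fF.
have [k fk] : exists k : 'I_N -> nat, forall i, F (k i) = f i.
  apply: (@fin_all_exists _ (fun=> nat) (fun i j => F j = f i)) => i.
  by have [j _ <-] := fF i; exists j.
have k_inj : injective k by move=> i j kij; apply: f_inj; rewrite -!fk kij.
pose h t := mpoly.meval (fun i => G (k i) t) P.
have ch : continuous h.
  by apply: (continuous_meval (g := G \o k)) => i; exact: cG.
have PfE t : mpoly.mmap (GRing.in_alg (plane_curve R)) f P t =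
    (h (x (set_val t)), h (y (set_val t))).
  rewrite curve_eval_mmap /h; congr (_, _);
    by apply: mpoly.meval_eq => i; rewrite -fk.
have h_onto (v : 'I_N -> R) : (forall i, 0 <= v i <= 1) ->
    exists2 t, 0 <= t <= 1 & h t = mpoly.meval v P.
  (* The target sequence has [v i] at index [k i], well defined since [k] is injective, and the
     default 0 at the other indices. *)
  move=> v01; pose a j := if [pick i | k i == j] is Some i then v i else 0.
  have [|t t01 Gt] := G_onto a _ (\max_i k i).+1.
    by move=> j; rewrite /a; case: pickP => // _; rewrite lexx ler01.
  exists t => //; apply: mpoly.meval_eq => i.
  rewrite [LHS]Gt ?ltnS ?leq_bigmax//.
  rewrite /a; case: pickP => [j /eqP/k_inj->//|/(_ i)]; by rewrite eqxx.
have [v v01 Pv] := mpoly_nonroot_cube P0.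
have [t t01 ht] := h_onto v v01.
(* The missing constant term gives [h] a zero [s], while [h t] is nonzero; hence [h] is not
   constant. *)
have [|s s01] := h_onto (fun=> 0); first by rewrite lexx ler01.
rewrite meval_at0 Pconst => hs.
split.
  (* A parameter [r] with [x r = t] makes the first coordinate of the curve equal to [h t]. *)
  apply: contraNneq Pv => Pf0; rewrite -ht.
  have [r [xr _]] := unit_itv_onto t t t01 t01.
  by have := PfE r; rewrite Pf0 xr => -[<-].
have [a [b hE]] := continuous_segment_image ch.
have hP r : 0 <= r <= 1 -> a <= h r <= b.
  move=> r01; have : (h @` `[0, 1]) (h r) by exists r => //; rewrite /= in_itv.
  by rewrite hE /= in_itv.
have h_ab q : a <= q <= b -> exists2 r, 0 <= r <= 1 & h r = q.
  move=> qab; have : `[a, b]%classic q by rewrite /= in_itv.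
  by rewrite -hE => -[r + <-]; rewrite /= in_itv; exists r.
apply: (@space_filling_square R a b).
  have := hP _ t01; have := hP _ s01; rewrite hs => /andP[a0 b0] /andP[at_ tb].
  rewrite lt_neqAle (le_trans a0 b0) andbT; apply: contraNneq Pv => ab.
  by rewrite -ht eq_le; apply/andP; split; lra.
(* For the converse inclusion, preimages of [p] and [q] under [h] are chosen separately and then
   reached together by [(x, y)]. *)
apply/seteqP; split => [_ [r _ <-]|[p q] [+ +]].
  by rewrite PfE; split; rewrite /= in_itv/= hP.
rewrite /= !in_itv/= => /h_ab[p' p'01 <-] /h_ab[q' q'01 <-].
have [r [xr yr]] := unit_itv_onto p' q' p'01 q'01.
by exists r; rewrite // PfE xr yr.
Qed.
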